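(* For any function $f:\{0,1\}^n\times\{0,1\}^n\to\{0,1\}$, any undirected graph $G=(V,E)$, any two distinct vertices $a,b\in V$ and any $\epsilon\ge0$, \[\tau_{\mathrm{route}}\big(G,\{a,b\},R^{(2)}_{\epsilon}(f)\big) \le 4\, R_{\epsilon}(f,G,\{a,b\}).\]
   Context: Communication model: $G=(V,E)$ is an undirected simple graph with terminals $a,b$; $a$ holds $\mathbf{x}_a\in\{0,1\}^n$, $b$ holds $\mathbf{x}_b\in\{0,1\}^n$, and both must learn $f(\mathbf{x}_a,\mathbf{x}_b)$. In each synchronous round every node sends a (possibly different) bit to each neighbour, both directions of an edge usable simultaneously; protocols know $G$ and use public randomness. $R_\epsilon(f,G,\{a,b\})$ is the minimum worst-case number of rounds of a protocol erring with probability at most $\epsilon$ on every input. $R^{(2)}_\epsilon(f)$ is the corresponding randomized round complexity in the two-party setting (Alice and Bob connected by a single link, each able to send one bit to the other simultaneously in each round). Timed graph: $G^{(\tau)}$ is the directed graph on $V\times[0,\tau]$ with unit-capacity edges $((u,i),(v,i+1))$, $((v,i),(u,i+1))$ for $(u,v)\in E$, $0\le i<\tau$, plus infinite-capacity edges $((u,i),(u,i+1))$. $\tau_{\mathrm{route}}(G,\{a,b\},n')$ is the minimum $\tau$ such that $n'$ units of flow can be sent from $(a,0)$ to $(b,\tau)$ in $G^{(\tau)}$ (the minimum number of rounds in which $a$ can route $n'$ units to $b$; this is symmetric in $a,b$). *)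

(* Defs.v *)
From mathcomp Require Import all_boot all_order all_algebra.
From mathcomp Require Import boolp reals.

Set Implicit Arguments.
Unset Strict Implicit.
Unset Printing Implicit Defensive.

Import Order.TTheory GRing.Theory Num.Theory.

(* Extended naturals are [option nat], with [None] for infinity. *)
Definition enat_le (x y : option nat) : bool :=
  match x, y with
  | _, None => true
  | None, Some _ => false
  | Some k, Some l => k <= l
  end.

(* [None] when no natural number satisfies [P] (minimum of the empty set). *)
Definition enat_min (P : nat -> Prop) : option nat :=
  if pselect (exists k, `[< P k >]) is left exP then Some (ex_minn exP)
  else None.

Section Protocols.

Variables (V : finType) (n : nat).

(* What a node has received so far: one entry per elapsed round, giving the
   bit received from each node ([false] for non-neighbours). *)
Definition view : Type := seq {ffun V -> bool}.

(* [send p u v x h] is the bit sent by [u] to [v] when the input of [u] is [x]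
   ([None] for non-terminals) and its view is [h]; the index of the current
   round is [size h]. *)
Record protocol := Protocol {
  send : V -> V -> option (n.-tuple bool) -> view -> bool;
  output : V -> option (n.-tuple bool) -> view -> bool
}.

Definition input_at (a b : V) (xa xb : n.-tuple bool) (v : V) :
    option (n.-tuple bool) :=
  if v == a then Some xa else if v == b then Some xb else None.

Fixpoint view_after (e : rel V) (p : protocol)
    (x : V -> option (n.-tuple bool)) (t : nat) (v : V) : view :=
  if t is t'.+1 then
    rcons (view_after e p x t' v)
      [ffun u => e u v && send p u v (x u) (view_after e p x t' u)]
  else [::].

Definition output_after (e : rel V) (p : protocol)
    (x : V -> option (n.-tuple bool)) (t : nat) (v : V) : bool :=
  output p v (x v) (view_after e p x t v).

Definition correct_after (f : n.-tuple bool -> n.-tuple bool -> bool)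
    (e : rel V) (a b : V) (p : protocol) (t : nat) (xa xb : n.-tuple bool) :
    bool :=
  (output_after e p (input_at a b xa xb) t a == f xa xb) &&
  (output_after e p (input_at a b xa xb) t b == f xa xb).

(* A public-coin protocol is a probability distribution [mu] over deterministic
   protocols. As finite-length protocols on finite inputs have only finitely
   many behaviours, finite sample spaces are enough. Protocols that may stop
   early are padded to their worst-case length [t]. *)
Definition computable_in (R : realType) (eps : R)
    (f : n.-tuple bool -> n.-tuple bool -> bool) (e : rel V) (a b : V)
    (t : nat) : Prop :=
  exists (Omega : finType) (mu : Omega -> R) (p : Omega -> protocol),
    [/\ forall w, (0 <= mu w)%R,
        (\sum_(w : Omega) mu w = 1)%R
      & forall xa xb : n.-tuple bool,
          (\sum_(w | ~~ correct_after f e a b (p w) t xa xb) mu w <= eps)%R].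

Definition round_complexity (R : realType) (eps : R)
    (f : n.-tuple bool -> n.-tuple bool -> bool) (e : rel V) (a b : V) :
    option nat :=
  enat_min (computable_in eps f e a b).

End Protocols.

(* The two-party setting is the single-edge graph on [bool]: Alice is [true],
   Bob is [false]. *)
Definition two_party_complexity (R : realType) (n : nat) (eps : R)
    (f : n.-tuple bool -> n.-tuple bool -> bool) : option nat :=
  round_complexity eps f (fun u v : bool => u != v) true false.

(* Capacity [None] is infinite; [Some 0] encodes a missing edge. *)
Definition is_flow (T : finType) (cap : T -> T -> option nat) (s t : T)
    (k : nat) (g : T -> T -> nat) : Prop :=
  [/\ forall x y, enat_le (Some (g x y)) (cap x y),
      forall x, x != s -> x != t -> \sum_y g y x = \sum_y g x y
    & \sum_y g s y = \sum_y g y s + k].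

Definition timed_cap (V : finType) (e : rel V) (tau : nat)
    (x y : V * 'I_tau.+1) : option nat :=
  if val y.2 == (val x.2).+1 then
    if x.1 == y.1 then None
    else if e x.1 y.1 then Some 1 else Some 0
  else Some 0.

Definition tau_route (V : finType) (e : rel V) (a b : V) (k : nat) :
    option nat :=
  enat_min (fun tau => exists g,
    is_flow (@timed_cap V e tau) (a, ord0) (b, ord_max) k g).

(* Main.v *)
(** Let a [t]-round protocol on the graph be given, and let [k] be the two-party
    complexity. If [k] units cannot be routed from [a] to [b] within [2 * t]
    rounds, max-flow min-cut yields a cut of capacity less than [k] in the timed
    graph. As waiting edges have infinite capacity, the cut is an increasing
    family [S 0, ..., S (2 * t)] of vertex sets, with [a] in all of them and [b]
    in none. Alice simulates at time [i] the vertices of [S (2 * t - i)], and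
    Bob those outside [S i]. These two sets cover the graph, so each player can
    supply the bits that the other one lacks. Alice lacks the bits crossing from
    outside [S (2 * t - i)] into [S (2 * t - i).-1], Bob those crossing from
    [S i] to outside [S i.+1]; all of them are distinct cut edges of the timed
    graph. Exchanging one such bit per round gives a two-party protocol with
    fewer than [k] rounds, a contradiction. *)
Require Import Defs.
From mathcomp Require Import all_boot all_order all_algebra.
From mathcomp Require Import boolp reals.
From mathcomp Require Import zify.

Set Implicit Arguments.
Unset Strict Implicit.
Unset Printing Implicit Defensive.

(** * Minima of sets of naturals *)

Lemma enat_minP (P : nat -> Prop) k :
  enat_min P = Some k -> P k /\ forall l, P l -> k <= l.
Proof.
rewrite /enat_min; case: pselect => // exP [<-].
case: ex_minnP => m /asboolP Pm min_m; split=> // l Pl.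
by apply: min_m; apply/asboolP.
Qed.

Lemma enat_min_ex (P : nat -> Prop) k :
  P k -> exists2 l, enat_min P = Some l & l <= k.
Proof.
move=> Pk; rewrite /enat_min; case: pselect => [exP|nexP].
  exists (ex_minn exP) => //; case: ex_minnP => m _ min_m.
  by apply: min_m; apply/asboolP.
by case: nexP; exists k; apply/asboolP.
Qed.

(** * Integral max-flow min-cut by augmenting paths *)

Section MaxFlowMinCut.

Variables (T : finType) (cap : T -> T -> option nat).

Definition feasible (g : T -> T -> nat) :=
  forall x y, enat_le (Some (g x y)) (cap x y).

Definition residual (g : T -> T -> nat) : rel T := fun x y =>
  enat_le (Some (g x y).+1) (cap x y) || (0 < g y x).

(** Spare capacity takes one more unit; otherwise a unit of the reverse edge is cancelled. The
    balance is stated additively because subtraction on [nat] truncates. *)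
Lemma push_residual (g : T -> T -> nat) x y :
    feasible g -> x != y -> residual g x y ->
  exists g', [/\ feasible g',
    forall v, \sum_w g' v w + \sum_w g w v + (v == y) =
              \sum_w g v w + \sum_w g' w v + (v == x)
    & forall v w, v != x -> w != x -> g' v w = g v w].
Proof.
move=> gF xy /orP[cap_xy|gyx].
- exists (fun v w => g v w + ((v == x) && (w == y))); split.
  + by move=> v w; case: andP => [[/eqP-> /eqP->]|_]; rewrite ?addn1 ?addn0.
  + move=> v; rewrite !big_split /=.
    have -> : \sum_w ((v == x) && (w == y)) = (v == x).
      rewrite (bigD1 y) //= eqxx andbT big1 ?addn0 // => w /negPf->.
      by rewrite andbF.
    have -> : \sum_w ((w == x) && (v == y)) = (v == y).
      by rewrite (bigD1 x) //= eqxx big1 ?addn0 // => w /negPf->.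
    lia.
  + by move=> v w /negPf-> _; rewrite addn0.
- exists (fun v w => g v w - ((v == y) && (w == x))); split.
  + move=> v w; have := gF v w; case: (cap v w) => //= c.
    by apply: leq_trans; apply: leq_subr.
  + have gE v w : g v w = g v w - ((v == y) && (w == x)) +
                          ((v == y) && (w == x)).
      by rewrite subnK //; case: andP => // -[/eqP-> /eqP->].
    move=> v.
    rewrite [X in _ + X + _ = _](eq_bigr _ (fun w _ => gE w v)).
    rewrite [X in _ = X + _ + _](eq_bigr _ (fun w _ => gE v w)).
    rewrite !big_split /=.
    have -> : \sum_w ((v == y) && (w == x)) = (v == y).
      rewrite (bigD1 x) //= eqxx andbT big1 ?addn0 // => w /negPf->.
      by rewrite andbF.
    have -> : \sum_w ((w == y) && (v == x)) = (v == x).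
      by rewrite (bigD1 y) //= eqxx big1 ?addn0 // => w /negPf->.
    lia.
  + by move=> v w _ /negPf->; rewrite andbF subn0.
Qed.

(** Pushing along the first edge alters only entries at [x]. The rest of a simple path avoids [x],
    so its edges stay residual. *)
Lemma push_residual_path p (g : T -> T -> nat) x :
    feasible g -> uniq (x :: p) -> path (residual g) x p ->
  exists2 g', feasible g' &
    forall v, \sum_w g' v w + \sum_w g w v + (v == last x p) =
              \sum_w g v w + \sum_w g' w v + (v == x).
Proof.
elim: p g x => [|y p IHp] g x gF; first by exists g.
move=> /andP[x_yp yp_uniq] /= /andP[xy yp_path].
have x_neq_y : x != y by apply: contraNneq x_yp => ->; rewrite mem_head.
have [g1 [g1F g1E g1_same]] := push_residual gF x_neq_y xy.
have [|g2 g2F g2E] := IHp g1 y g1F yp_uniq.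
  apply: (sub_in_path (P := mem (y :: p))) yp_path => [v w v_yp w_yp|].
    by rewrite /residual !g1_same //; apply: contraNneq x_yp => <-.
  exact/allP.
by exists g2 => // v; have := g1E v; have := g2E v => /=; lia.
Qed.

(** Induction on [k]: a flow of value [k] is augmented along a residual path or, if [t] is
    unreachable, the reachable set is a cut of capacity at most [k]. *)
Lemma max_flow_min_cut s t k : s != t ->
  (exists g, is_flow cap s t k g) \/
  (exists S : {set T}, [/\ s \in S, t \notin S,
     forall x y, x \in S -> y \notin S -> cap x y <> None
     & \sum_(x in S) \sum_(y in ~: S) odflt 0 (cap x y) < k]).
Proof.
move=> st; elim: k => [|k [[g [gF g_cons g_val]]|]]; last first.
- move=> [S [sS tS Sfin Sk]]; right; exists S; split=> //; exact: ltnW.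
- have [st_con|st_con] := boolP (connect (residual g) s t).
    left; move/connectP: st_con => [p0 p0_path t_last].
    move: t_last; case/shortenP: p0_path => p p_path p_uniq _ t_last.
    have [g' g'F g'E] := push_residual_path gF p_uniq p_path.
    exists g'; split=> //.
      move=> x xs xt; have := g'E x; rewrite -t_last (negPf xs) (negPf xt).
      by have := g_cons x xs xt; lia.
    by have := g'E s; rewrite -t_last eqxx (negPf st) g_val; lia.
  right; pose S := [set x | connect (residual g) s x].
  (* Otherwise the edge is residual and [y] is reachable too. *)
  have cutS x y : x \in S -> y \notin S -> cap x y = Some (g x y) /\ g y x = 0.
    rewrite !inE => sx; apply: contraNP => xy.
    apply: (connect_trans sx); apply: connect1; apply: contra_notT xy.
    rewrite /residual negb_or => /andP[]; have := gF x y.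
    by case: (cap x y) => //= c; split; [congr Some|]; lia.
  exists S; split.
  + by rewrite inE connect0.
  + by rewrite inE.
  + by move=> x y xS yS; have [-> _] := cutS x y xS yS.
  have balance : \sum_(x in S) \sum_y g x y = \sum_(x in S) \sum_y g y x + k.
    have sS : s \in S by rewrite inE connect0.
    rewrite (bigD1 s) //= [in RHS](bigD1 s) //= g_val.
    have -> : \sum_(x in S | x != s) \sum_y g x y =
              \sum_(x in S | x != s) \sum_y g y x; last lia.
    apply: eq_bigr => x /andP[xS xs]; rewrite g_cons //.
    by apply: contraNneq st_con => <-; rewrite inE in xS.
  have splitS (h : T -> T -> nat) : \sum_(x in S) \sum_y h x y =
      \sum_(x in S) \sum_(y in S) h x y + \sum_(x in S) \sum_(y in ~: S) h x y.
    rewrite -big_split; apply: eq_bigr => x _ /=.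
    by rewrite (bigID (mem S)) /=; congr addn; apply: eq_bigl => y; rewrite in_setC.
  (* Flow inside [S] cancels, so exactly [k] units leave [S]. *)
  move: balance; rewrite splitS (splitS (fun x y => g y x)) exchange_big /=.
  rewrite [X in _ = _ + X + _]big1 => [|x xS]; last first.
    by rewrite big1 // => y; rewrite in_setC => yS; case: (cutS x y xS yS).
  rewrite addn0 => /addnI <-; rewrite ltnS; apply: leq_sum => x xS.
  apply: leq_sum => y; rewrite in_setC => yS.
  by case: (cutS x y xS yS) => ->.
- left; exists (fun _ _ => 0); split=> //= [x y|]; last by rewrite !big1.
  by case: (cap x y).
Qed.

End MaxFlowMinCut.

(** * Two-party simulation of a network protocol *)

Section Simulation.

Variables (V : finType) (n : nat) (e : rel V) (a b : V) (t : nat).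

(* Alice is [true], Bob is [false], and [C c i] is the set of vertices which
   player [c] simulates at time [i]. *)
Variable C : bool -> nat -> {set V}.

(* The schedule: [(i, u, v)] stands for the bit sent by [u] to [v] in round
   [i]. *)
Variable L : seq (nat * V * V).

Definition terminal (c : bool) : V := if c then a else b.

Definition local_input (c : bool) (x : option (n.-tuple bool)) (u : V) :=
  if u == terminal c then x else None.

(** Views are computed at every vertex but are meaningful only on [D i]; [missing] supplies the bits
    sent from outside. *)
Fixpoint simulate (p : protocol V n) (inp : V -> option (n.-tuple bool))
    (D : nat -> {set V}) (missing : nat -> V -> V -> bool) (i : nat) (v : V) :
    view V :=
  if i is i'.+1 then
    rcons (simulate p inp D missing i' v)
      [ffun u => e u v &&
         if u \in D i' then send p u v (inp u) (simulate p inp D missing i' u)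
         else missing i' u v]
  else [::].

Definition received (c : bool) (h : view bool) (i : nat) (u v : V) : bool :=
  nth [ffun=> false] h (index (i, u, v) L) (~~ c).

(* In round [r] both players send their own guess of the bit scheduled at [r];
   at least one of these guesses is right. *)
Definition two_party_protocol (p : protocol V n) : protocol bool n :=
  Protocol
    (fun c _ x h =>
       let: (i, u, v) := nth (0, a, a) L (size h) in
       send p u v (local_input c x u)
         (simulate p (local_input c x) (C c) (received c h) i u))
    (fun c x h =>
       output p (terminal c) x
         (simulate p (local_input c x) (C c) (received c h) t (terminal c))).

Hypothesis a_neq_b : a != b.
Hypothesis C_cover : forall c i u, i < t -> u \notin C c i -> u \in C (~~ c) i.
Hypothesis C_terminal : forall c i, i <= t -> terminal (~~ c) \notin C c i.
Hypothesis C_final : forall c, terminal c \in C c t.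
Hypothesis L_sorted : sorted (relpre (fun m => m.1.1) leq) L.
Hypothesis L_complete : forall c i u v, i < t -> e u v ->
  u \notin C c i -> v \in C c i.+1 -> (i, u, v) \in L.
Hypothesis C_step : forall c i u, i < t -> u \in C c i.+1 -> u \in C c i.

Section Run.

Variables (p : protocol V n) (xa xb : n.-tuple bool).

Let X := input_at a b xa xb.
Let X2 := input_at true false xa xb.
Let q := two_party_protocol p.
Let run2 := view_after (fun u v : bool => u != v) q X2.

(** The two sides can differ only at the other player's terminal, which [c] never simulates. *)
Lemma local_inputE c i u : i <= t -> u \in C c i ->
  local_input c (X2 c) u = X u.
Proof.
move=> it uC; have := C_terminal c it; rewrite /local_input /X2 /X /input_at.
case: c uC => /= uC otherC.
  by case: eqP => // _; case: eqP => // ub; rewrite -ub uC in otherC.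
case: (u =P a) => [ua|_]; last by case: eqP.
by rewrite -ua uC in otherC.
Qed.

(** The simulated sets shrink with time, so a vertex of [C c m] has a correct earlier view to
    extend. *)
Lemma simulate_correct c missing m : m <= t ->
    (forall i u v, i < m -> e u v -> u \notin C c i -> v \in C c i.+1 ->
       missing i u v = send p u v (X u) (view_after e p X i u)) ->
  forall v, v \in C c m ->
  simulate p (local_input c (X2 c)) (C c) missing m v = view_after e p X m v.
Proof.
elim: m => [//|m IHm] mt missingE v vC /=.
have IH := IHm (ltnW mt) (fun i u v im => missingE i u v (ltnW im)).
rewrite (IH _ (C_step mt vC)); congr rcons; apply/ffunP => u; rewrite !ffunE.
case: (boolP (e u v)) => //= uv; case: (boolP (u \in C c m)) => uC.
  by rewrite IH // (@local_inputE c m) // ltnW.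
by rewrite missingE.
Qed.

Lemma size_run2 r c : size (run2 r c) = r.
Proof. by elim: r c => //= r IHr c; rewrite size_rcons IHr. Qed.

Lemma nth_run2 s r c : r < s ->
  nth [ffun=> false] (run2 s c) r (~~ c) =
  send q (~~ c) c (X2 (~~ c)) (run2 r (~~ c)).
Proof.
elim: s => //= s IHs; rewrite nth_rcons size_run2 ltnS leq_eqVlt.
case: ltnP => [rs _|_]; first exact: IHs.
by rewrite orbF => /[dup] /eqP<- ->; rewrite ffunE; case: c {IHs}.
Qed.

(** Induction on the elapsed rounds: the other player simulates [u], and the bits needed for this
    belong to rounds before [i], hence come earlier in the sorted schedule. *)
Lemma received_correct s c i u v : i < t -> e u v -> u \notin C c i ->
    v \in C c i.+1 -> index (i, u, v) L < s ->
  received c (run2 s c) i u v = send p u v (X u) (view_after e p X i u).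
Proof.
elim/ltn_ind: s c i u v => s IHs c i u v it uv uC vC rs.
have mL := L_complete it uv uC vC.
rewrite /received nth_run2 //= size_run2 nth_index //=.
have uC' := C_cover it uC.
rewrite (local_inputE (ltnW it) uC') simulate_correct ?(ltnW it) //.
move=> j u' v' ji u'v' u'C v'C; apply: IHs => //; first exact: ltn_trans it.
have m'L := L_complete (ltn_trans ji it) u'v' u'C v'C.
rewrite ltnNge; apply/negP => le_idx; move: ji.
have := sorted_leq_nth _ _ (0, a, a) L_sorted _ _ _ _ le_idx.
rewrite !inE !index_mem !nth_index //= leqNgt.
move=> /(_ _ _ mL m'L)/negP; apply => //.
- by move=> ? ? ? /=; apply: leq_trans.
- by move=> ? /=.
Qed.

Lemma two_party_correct f :
  correct_after f (fun u v : bool => u != v) true false q (size L) xa xb =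
  correct_after f e a b p t xa xb.
Proof.
have outE c : output_after (fun u v : bool => u != v) q X2 (size L) c =
              output_after e p X t (terminal c).
  rewrite /output_after /= simulate_correct //.
    congr output; case: c; rewrite /X2 /X /input_at /= eqxx //.
    by rewrite eq_sym (negPf a_neq_b).
  move=> i u v it uv uC vC; apply: received_correct => //.
  by rewrite index_mem (L_complete it uv uC vC).
by rewrite /correct_after (outE true) (outE false).
Qed.

End Run.

Lemma two_party_computable (R : realType) (eps : R)
    (f : n.-tuple bool -> n.-tuple bool -> bool) :
  computable_in eps f e a b t ->
  computable_in eps f (fun u v : bool => u != v) true false (size L).
Proof.
move=> [Omega [mu [p [mu_ge0 mu_sum err]]]].
exists Omega, mu, (fun w => two_party_protocol (p w)); split=> // xa xb.
by under eq_bigl do rewrite two_party_correct.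
Qed.

End Simulation.

(** * Schedule obtained from an increasing family of vertex sets *)

Section MovingCut.

Variables (V : finType) (n : nat) (e : rel V) (a b : V) (t : nat).
Variable S : nat -> {set V}.

Definition crossing : {set 'I_t * V * V} :=
  [set m : 'I_t * V * V | let: (i, u, v) := m in e u v &&
     ((u \notin S (2 * t - i)) && (v \in S (2 * t - i.+1)) ||
      (u \in S i) && (v \notin S i.+1))].

Hypothesis a_neq_b : a != b.
Hypothesis S_mono : forall i j, i <= j <= 2 * t -> S i \subset S j.
Hypothesis aS : a \in S 0.
Hypothesis bS : b \notin S (2 * t).

Lemma moving_cut_computable (R : realType) (eps : R)
    (f : n.-tuple bool -> n.-tuple bool -> bool) :
  computable_in eps f e a b t ->
  computable_in eps f (fun u v : bool => u != v) true false #|crossing|.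
Proof.
(* Both sets shrink with [i], and they cover the graph because [i <= 2 * t - i]. *)
pose C (c : bool) i := if c then S (2 * t - i) else ~: S i.
pose forget (m : 'I_t * V * V) : nat * V * V := (val m.1.1, m.1.2, m.2).
pose L := sort (relpre (fun m : nat * V * V => m.1.1) leq)
               [seq forget m | m <- enum crossing].
have -> : #|crossing| = size L by rewrite size_sort size_map cardE.
have aSi i : i <= 2 * t -> a \in S i.
  by move=> it; apply: subsetP aS; apply: S_mono.
have bSi i : i <= 2 * t -> b \notin S i.
  move=> it; apply: contra bS; apply/subsetP; apply: S_mono.
  by rewrite it leqnn.
apply: (two_party_computable (C := C)) => //.
- move=> [] i u it /=; rewrite !inE ?negbK; last first.
    by apply: (subsetP (S_mono _)); lia.
  by apply: contra; apply: (subsetP (S_mono _)); lia.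
- by move=> [] i it /=; rewrite ?inE ?negbK ?aSi ?bSi; lia.
- by move=> [] /=; rewrite ?inE ?aSi ?bSi; lia.
- by apply: sort_sorted => m m' /=; apply: leq_total.
- move=> c i u v it uv uC vC; rewrite mem_sort; apply/mapP.
  exists (Ordinal it, u, v) => //; rewrite mem_enum inE uv /=.
  case: c uC vC => /=; first by move=> -> ->.
  by rewrite !inE negbK => -> ->; rewrite orbT.
- move=> [] i u it /=; rewrite ?inE; last apply: contra;
    by apply: (subsetP (S_mono _)); lia.
Qed.

End MovingCut.

(** A constant cut isolating [b] shows that the two-party complexity is finite. *)
Lemma two_party_computable_ex (R : realType) (eps : R) n
    (f : n.-tuple bool -> n.-tuple bool -> bool) (V : finType) (e : rel V)
    (a b : V) t :
  a != b -> computable_in eps f e a b t ->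
  exists k, computable_in eps f (fun u v : bool => u != v) true false k.
Proof.
move=> ab comp; exists #|crossing e t (fun=> [set~ b])|.
by apply: moving_cut_computable comp; rewrite ?inE ?eqxx.
Qed.

(** * From cuts of the timed graph to moving cuts *)

Section TimedCut.

Variables (V : finType) (e : rel V) (t : nat).
Hypotheses (e_sym : symmetric e) (e_irr : irreflexive e).

Variable S : {set V * 'I_(2 * t).+1}.
Hypothesis S_fin : forall x y, x \in S -> y \notin S ->
  timed_cap e x y <> None.

Definition time_slice i : {set V} := [set v | (v, inord i) \in S].

(** A vertex leaving the family would put an infinite waiting edge into the cut. *)
Lemma time_slice_mono i j : i <= j <= 2 * t -> time_slice i \subset time_slice j.
Proof.
elim: j => [|j IHj]; first by rewrite leqn0 andbT => /eqP->.
case/andP; rewrite leq_eqVlt => /orP[/eqP->//|ij] jt.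
apply: subset_trans (IHj _) _; first by lia.
apply/subsetP => v; rewrite !inE => vj; case: (boolP (_ \in S)) => // vj1.
by have := S_fin vj vj1; rewrite /timed_cap /= !inordK ?eqxx //; lia.
Qed.

Definition cut_edge (m : 'I_t * V * V) :
    (V * 'I_(2 * t).+1) * (V * 'I_(2 * t).+1) :=
  let: (i, u, v) := m in
  if (u \notin time_slice (2 * t - i)) && (v \in time_slice (2 * t - i.+1))
  then ((v, inord (2 * t - i.+1)), (u, inord (2 * t - i)))
  else ((u, inord i), (v, inord i.+1)).

(** Alice's edges start at times at least [t] and Bob's before [t], so the two kinds never
    collide. *)
Lemma cut_edge_inj : injective cut_edge.
Proof.
move=> [[i u] v] [[j u'] v'] /=; have := ltn_ord i; have := ltn_ord j => jt it.
by case: ifP => _; case: ifP => _;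
  move=> /(congr1 (fun z => (z.1.1, val z.1.2, z.2.1)));
  rewrite /= !inordK; try lia; move=> [-> ij ->]; try lia;
  congr (_, _, _); apply: val_inj => /=; lia.
Qed.

Lemma card_crossing_le :
  #|crossing e t time_slice| <=
  \sum_(x in S) \sum_(y in ~: S) odflt 0 (timed_cap e x y).
Proof.
rewrite -(card_imset _ cut_edge_inj) -sum1_card pair_big_dep /=.
rewrite big_mkcond [leqRHS]big_mkcond /=; apply: leq_sum => xy _.
case: ifP => // /imsetP[[[i u] v]]; have it := ltn_ord i.
rewrite inE => /andP[uv]; rewrite /cut_edge.
(* A loop would give a waiting edge, which [odflt 0] counts as 0. *)
have neq_uv : u != v by apply: contraTneq uv => ->; rewrite e_irr.
case: ifP => [/andP[uS vS] _ ->|_ /= /andP[uS vS] ->] /=;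
  move: uS vS; rewrite !inE => uS vS;
  rewrite uS vS /= /timed_cap /= !inordK; try lia.
  by rewrite (eq_sym v) (negPf neq_uv) e_sym uv; case: eqP => //; lia.
by rewrite (negPf neq_uv) uv eqxx.
Qed.

End TimedCut.

Theorem theorem1p4 (R : realType) (n : nat)
    (f : n.-tuple bool -> n.-tuple bool -> bool)
    (V : finType) (e : rel V) (e_sym : symmetric e) (e_irr : irreflexive e)
    (a b : V) (a_neq_b : a != b) (eps : R) (eps_ge0 : (0 <= eps)%R) :
  enat_le (obind (tau_route e a b) (two_party_complexity eps f))
          (omap (muln 4) (round_complexity eps f e a b)).
Proof.
case tE : (round_complexity eps f e a b) => [t|] /=; last first.
  by case: (obind _ _).
have [comp _] := enat_minP tE.
have [k0 comp2] := two_party_computable_ex a_neq_b comp.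
have [k kE _] := enat_min_ex comp2.
have [_ k_min] := enat_minP kE.
rewrite /two_party_complexity /round_complexity kE /=.
have st : (a, ord0) != (b, ord_max) :> V * 'I_(2 * t).+1.
  by rewrite xpair_eqE negb_and a_neq_b.
have [[g g_flow]|] := max_flow_min_cut (@timed_cap V e (2 * t)) k st.
  have [l lE lt] := enat_min_ex (ex_intro _ g g_flow : (fun tau => exists g,
    is_flow (@timed_cap V e tau) (a, ord0) (b, ord_max) k g) (2 * t)).
  (* The route takes at most [2 * t] rounds, within the claimed [4 * t]. *)
  by rewrite /tau_route lE /=; lia.
move=> [S [aS bS S_fin]]; rewrite ltnNge => /negP[].
(* The crossing bits give a two-party protocol, so minimality of [k] bounds the cut from below. *)
apply: leq_trans (card_crossing_le e_sym e_irr S); apply: k_min.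
apply: (moving_cut_computable a_neq_b _ _ _ comp).
- exact: time_slice_mono S_fin.
- by rewrite inE (_ : inord 0 = ord0) //; apply: val_inj; rewrite /= inordK.
- rewrite inE (_ : inord _ = ord_max) //.
  by apply: val_inj; rewrite /= inordK.
Qed.
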